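(* Let $d$ be a positive integer and let $f$ be a smooth height function. Suppose that, at a point, the position, gradient and Hessian of $f$ are approximated to $O(h^{d+1})$, $O(h^d)$ and $O(h^{d-1})$, respectively, as the mesh size $h\to0$. Then: (a) the angle between the computed and exact unit normals is $O(h^d)$; (b) the components of the shape operator and of the curvature tensor are approximated to $O(h^{d-1})$ by the formulas $$\tilde{\mathbf{W}}=\frac1\ell\begin{bmatrix}c/\ell&s/\ell\\ -s&c\end{bmatrix}\mathbf{H}\begin{bmatrix}c/\ell&-s\\ s/\ell&c\end{bmatrix}\quad\text{and}\quad \mathbf{C}=\frac1\ell\mathbf{J}^{+T}\mathbf{H}\mathbf{J}^{+};$$ (c) the Gaussian and mean curvatures are approximated to $O(h^{d-1})$ by the formulas $$\kappa_G=\frac{\det(\mathbf{H})}{\ell^4},\qquad \kappa_H=\frac{\operatorname{tr}(\mathbf{H})}{2\ell}-\frac{(\nabla f)^T\mathbf{H}(\nabla f)}{2\ell^3}.$$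
   Context: A height function is a smooth function $f$ from an open subset of $\mathbb{R}^2$ to $\mathbb{R}$, with surface $[u,v,f(u,v)]^T$; $\nabla f=[f_u,f_v]^T$ is the gradient, $\mathbf{H}$ the (symmetric) Hessian, and $\ell=\sqrt{1+f_u^2+f_v^2}$. The unit normal is $\hat{\mathbf{n}}=\frac1\ell[-f_u,-f_v,1]^T$. The scalars $c,s$ are $c=f_u/\|\nabla f\|$, $s=f_v/\|\nabla f\|$, with the convention $c=1$, $s=0$ when $f_u=f_v=0$. The matrix $\tilde{\mathbf{W}}$ is the symmetric shape operator, i.e. the shape operator in the orthonormal basis of the tangent plane $\mathbf{u}_1=[c/\ell,s/\ell,\|\nabla f\|/\ell]^T$, $\mathbf{u}_2=[-s,c,0]^T$. The $3\times3$ matrix $\mathbf{C}$ is the (principal) curvature tensor, where $\mathbf{J}^+=\frac1{\ell^2}\begin{bmatrix}1+f_v^2&-f_uf_v&f_u\\ -f_uf_v&1+f_u^2&f_v\end{bmatrix}$ is the pseudo-inverse of the Jacobian $\mathbf{J}=\begin{bmatrix}1&0\\ 0&1\\ f_u&f_v\end{bmatrix}$ and $\mathbf{J}^{+T}=(\mathbf{J}^+)^T$. $\kappa_H$ and $\kappa_G$ are the mean and Gaussian curvatures. ''Computed'' quantities are those obtained by inserting the approximate gradient and approximate (symmetric) Hessian into the displayed formulas in place of the exact ones; ''approximated to $O(h^q)$'' means that the difference between computed and exact quantity is $O(h^q)$ as $h\to0$ (componentwise for vectors and matrices), with $f$, the point and $d$ fixed.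
   Formalization: In (b), at points where the gradient of f vanishes and d ≥ 2, the claim for the shape operator fails literally because c, s are discontinuous; there the computed matrix is compared with the exact shape operator in the frame given by the computed c, s. *)

(* Defs.v *)
From HB Require Import structures.
From mathcomp Require Import all_boot all_order all_algebra.
From mathcomp Require Import all_classical all_reals all_analysis.
Set Implicit Arguments.
Unset Strict Implicit.
Unset Printing Implicit Defensive.
Import Order.TTheory GRing.Theory Num.Theory.
Import numFieldNormedType.Exports.
Local Open Scope classical_set_scope.
Local Open Scope ring_scope.

Section Smooth.
Context {R : realType}.
Implicit Types (f : 'cV[R]_2 -> R) (p : 'cV[R]_2).

Definition basis_vec (i : 'I_2) : 'cV[R]_2 := delta_mx i 0.

Definition partial (i : 'I_2) f : 'cV[R]_2 -> R :=
  fun p => 'D_(basis_vec i) f p.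

(* [iter_partial [:: i; j] f] is d_i (d_j f). *)
Definition iter_partial (s : seq 'I_2) f : 'cV[R]_2 -> R := foldr partial f s.

(* f is total, but for U open only its values on U matter. *)
Definition smooth_on (U : set 'cV[R]_2) f : Prop :=
  forall (s : seq 'I_2) p, U p ->
    {for p, continuous (iter_partial s f)} /\
    forall i, derivable (iter_partial s f) p (basis_vec i).

Definition gradient f p : 'cV[R]_2 := \col_i partial i f p.

Definition hessian f p : 'M[R]_2 := \matrix_(i, j) partial i (partial j f) p.

End Smooth.

Section Formulas.
Context {R : realType}.
Implicit Types (g : 'cV[R]_2) (H : 'M[R]_2) (c s : R).

Definition mx_of_rows m n (rows : seq (seq R)) : 'M[R]_(m, n) :=
  \matrix_(i, j) (nth [::] rows i)`_j.

Definition dotc n (x y : 'cV[R]_n) : R := \sum_i x i 0 * y i 0.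

Definition enorm n (x : 'cV[R]_n) : R := Num.sqrt (dotc x x).

Definition angle n (x y : 'cV[R]_n) : R := acos (dotc x y / (enorm x * enorm y)).

(* In the formulas below g = [f_u, f_v]^T stands for the exact or for the
   computed gradient, and H for the exact or the computed Hessian. *)
Definition ell g : R := Num.sqrt (1 + g 0 0 ^+ 2 + g 1 0 ^+ 2).

Definition unit_normal g : 'cV[R]_3 :=
  (ell g)^-1 *: mx_of_rows 3 1 [:: [:: - g 0 0]; [:: - g 1 0]; [:: 1]].

(* Both are discontinuous at g = 0. *)
Definition dir_c g : R := if g == 0 then 1 else g 0 0 / enorm g.
Definition dir_s g : R := if g == 0 then 0 else g 1 0 / enorm g.

Definition jac g : 'M[R]_(3, 2) :=
  mx_of_rows 3 2 [:: [:: 1; 0]; [:: 0; 1]; [:: g 0 0; g 1 0]].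

Definition jac_pinv g : 'M[R]_(2, 3) :=
  (ell g ^+ 2)^-1 *: mx_of_rows 2 3
    [:: [:: 1 + g 1 0 ^+ 2; - (g 0 0 * g 1 0); g 0 0];
        [:: - (g 0 0 * g 1 0); 1 + g 0 0 ^+ 2; g 1 0]].

(* The columns are u_1 and u_2. *)
Definition tangent_frame g c s : 'M[R]_(3, 2) :=
  mx_of_rows 3 2 [:: [:: c / ell g; - s];
                     [:: s / ell g; c];
                     [:: enorm g / ell g; 0]].

Definition shape_formula g H : 'M[R]_2 :=
  let l := ell g in let c := dir_c g in let s := dir_s g in
  l^-1 *: (mx_of_rows 2 2 [:: [:: c / l; s / l]; [:: - s; c]] *m H *m
           mx_of_rows 2 2 [:: [:: c / l; - s]; [:: s / l; c]]).

Definition tensor_formula g H : 'M[R]_3 :=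
  (ell g)^-1 *: ((jac_pinv g)^T *m H *m jac_pinv g).

Definition gauss_formula g H : R := \det H / ell g ^+ 4.

Definition mean_formula g H : R :=
  \tr H / (2 * ell g) - (g^T *m H *m g) 0 0 / (2 * ell g ^+ 3).

End Formulas.

Section ExactQuantities.
Context {R : realType}.
Implicit Types (f : 'cV[R]_2 -> R) (p : 'cV[R]_2).

Definition surface f p : 'cV[R]_3 :=
  mx_of_rows 3 1 [:: [:: p 0 0]; [:: p 1 0]; [:: f p]].

Definition first_form f p : 'M[R]_2 :=
  (jac (gradient f p))^T *m jac (gradient f p).

Definition second_form f p : 'M[R]_2 :=
  \matrix_(i, j) dotc (unit_normal (gradient f p))
    (\col_k partial i (partial j (fun q => surface f q k 0)) p).

(* Shape operator in the basis (x_u, x_v) of the tangent plane. *)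
Definition weingarten f p : 'M[R]_2 :=
  invmx (first_form f p) *m second_form f p.

(* Matrix of the shape operator in the orthonormal tangent frame (u_1, u_2)
   given by (c, s): the (i, j) entry is u_i . S(u_j), where J^+ u_j is the
   coordinate vector of u_j in the basis (x_u, x_v).  Where the gradient
   vanishes, every unit vector (c, s) gives an orthonormal tangent frame. *)
Definition shape_operator_in f p (c s : R) : 'M[R]_2 :=
  let g := gradient f p in let u := tangent_frame g c s in
  u^T *m (jac g *m weingarten f p *m (jac_pinv g *m u)).

Definition shape_operator f p : 'M[R]_2 :=
  shape_operator_in f p (dir_c (gradient f p)) (dir_s (gradient f p)).

Definition gauss_curvature f p : R := \det (weingarten f p).

Definition mean_curvature f p : R := \tr (weingarten f p) / 2.

(* C = k_1 e_1 e_1^T + k_2 e_2 e_2^T, with k_i the principal curvatures and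
   e_i = J d_i orthonormal principal directions in R^3. *)
Definition is_curvature_tensor f p (C : 'M[R]_3) : Prop :=
  exists (k1 k2 : R) (d1 d2 : 'cV[R]_2),
    let e1 := jac (gradient f p) *m d1 in
    let e2 := jac (gradient f p) *m d2 in
    [/\ weingarten f p *m d1 = k1 *: d1, weingarten f p *m d2 = k2 *: d2,
        [/\ dotc e1 e1 = 1, dotc e2 e2 = 1 & dotc e1 e2 = 0] &
        C = k1 *: (e1 *m e1^T) + k2 *: (e2 *m e2^T)].

End ExactQuantities.

Section Approximation.
Context {R : realType}.

Definition is_Oh (q : nat) (a : R -> R) : Prop :=
  a =O_ (0^'+) (fun h : R => h ^+ q).

Definition approx_mx m n (q : nat) (A B : R -> 'M[R]_(m, n)) : Prop :=
  forall i j, is_Oh q (fun h => A h i j - B h i j).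

End Approximation.

(* Main.v *)
(* Every quantity is obtained from the gradient and the Hessian by sums,
   products, and by inverses and square roots of functions bounded below by a
   positive constant ([ell >= 1]); each of these operations preserves agreement
   up to O(h^q) of bounded functions.  It remains to see that the formulas
   evaluated at the exact data give the exact quantities, which is algebra with
   G^-1 = (J^T J)^-1, J^+ = G^-1 J^T and L = H / ell.
   The direction [(c, s)] is singular where the gradient vanishes, but there the
   exact shape operator is given by the same formula for every unit vector
   [(c, s)], so the computed [(c, s)] can be used on both sides.
   For the angle t between the normals n and n', 1 - cos t = |n - n'|^2 / 2 is
   O(h^(2d)), and t^2 <= 8 (1 - cos t) for small t. *)
Require Import Defs.
From HB Require Import structures.
From mathcomp Require Import all_boot all_order all_algebra.
From mathcomp Require Import all_classical all_reals all_analysis.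
From mathcomp Require Import ring lra.
Import Order.TTheory GRing.Theory Num.Theory.
Import numFieldNormedType.Exports.
Local Open Scope classical_set_scope.
Local Open Scope ring_scope.

(** * Arithmetic of O(h^q) bounds and of agreement up to O(h^q) *)

Section BigOh.
Context {R : realType}.
Implicit Types (q : nat) (a b x y : R -> R).

(** To the right of 0 the power [h ^+ q] is its own absolute value. The constant may have any sign
    here, so the converse enlarges it to [Num.max k 1] to obtain a positive one. *)
Lemma is_OhP q a :
  is_Oh q a <-> exists k : R, \forall h \near 0^'+, `|a h| <= k * h ^+ q.
Proof.
rewrite /is_Oh eqO_exP; split=> [[k _ ak]|[k ak]].
  exists k; near=> h.
  have h0 : 0 < h by near: h; exact: nbhs_right_gt.
  have : `|a h| <= k * `|h ^+ q| by near: h.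
  by rewrite [X in _ * X]ger0_norm// exprn_ge0// ltW.
exists (Num.max k 1); first by rewrite lt_max ltr01 orbT.
near=> h.
have h0 : 0 < h by near: h; exact: nbhs_right_gt.
rewrite [X in _ * X]ger0_norm ?exprn_ge0 ?(ltW h0)//.
apply: (@le_trans _ _ (k * h ^+ q)); first by near: h.
by rewrite ler_wpM2r ?exprn_ge0 ?(ltW h0)// le_max lexx.
Unshelve. all: by end_near. Qed.

Lemma is_Oh_le q a b :
  (\forall h \near 0^'+, `|a h| <= `|b h|) -> is_Oh q b -> is_Oh q a.
Proof.
move=> ab /is_OhP[k bk]; apply/is_OhP; exists k; near=> h.
by apply: (@le_trans _ _ `|b h|); near: h.
Unshelve. all: by end_near. Qed.

Lemma is_Oh_cst (k : R) : is_Oh 0 (fun=> k).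
Proof.
by apply/is_OhP; exists `|k|; near=> h; rewrite mulr1.
Unshelve. all: by end_near. Qed.

Lemma is_Oh0 q : is_Oh q (fun=> 0 : R).
Proof.
by apply/is_OhP; exists 0; near=> h; rewrite normr0 mul0r.
Unshelve. all: by end_near. Qed.

Lemma is_OhW p q a : (p <= q)%N -> is_Oh q a -> is_Oh p a.
Proof.
(* Passing from h^q to the larger h^p, for h <= 1, needs a nonnegative constant, hence the absolute
   value. *)
move=> pq /is_OhP[k ak]; apply/is_OhP; exists `|k|; near=> h.
have h0 : 0 < h by near: h; exact: nbhs_right_gt.
have h1 : h <= 1 by near: h; apply: nbhs_right_le.
apply: (@le_trans _ _ (k * h ^+ q)); first by near: h.
apply: (@le_trans _ _ (`|k| * h ^+ q)).
  by rewrite ler_wpM2r ?ler_norm ?exprn_ge0 ?(ltW h0).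
by rewrite ler_wpM2l// ler_wiXn2l// ltW.
Unshelve. all: by end_near. Qed.

Lemma is_OhD q a b : is_Oh q a -> is_Oh q b -> is_Oh q (fun h => a h + b h).
Proof.
move=> /is_OhP[k ak] /is_OhP[l bl]; apply/is_OhP; exists (k + l); near=> h.
rewrite (le_trans (ler_normD _ _))// mulrDl lerD//; by near: h.
Unshelve. all: by end_near. Qed.

Lemma is_OhM p q a b :
  is_Oh p a -> is_Oh q b -> is_Oh (p + q) (fun h => a h * b h).
Proof.
move=> /is_OhP[k ak] /is_OhP[l bl]; apply/is_OhP; exists (k * l); near=> h.
rewrite exprD mulrACA normrM ler_pM//; by near: h.
Unshelve. all: by end_near. Qed.

Lemma is_OhN q a : is_Oh q a -> is_Oh q (fun h => - a h).
Proof.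
by apply: is_Oh_le; near=> h; rewrite normrN.
Unshelve. all: by end_near. Qed.

Lemma is_OhB q a b : is_Oh q a -> is_Oh q b -> is_Oh q (fun h => a h - b h).
Proof. by move=> aq bq; apply: is_OhD => //; exact: is_OhN. Qed.

(* Boundedness of [b] makes this relation stable under products. *)
Definition fapprox q a b := is_Oh q (fun h => a h - b h) /\ is_Oh 0 b.

Lemma approxW p q a b : (p <= q)%N -> fapprox q a b -> fapprox p a b.
Proof. by move=> pq [ab b0]; split=> //; exact: is_OhW ab. Qed.

Lemma approx_bounded q a b : fapprox q a b -> is_Oh 0 a.
Proof.
move=> [ab b0]; rewrite (_ : a = fun h => (a h - b h) + b h); last first.
  by apply/funext => h; rewrite subrK.
by apply: is_OhD => //; exact: is_OhW ab.
Qed.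

Lemma approx_refl q a : is_Oh 0 a -> fapprox q a a.
Proof.
by move=> a0; split=> //; under eq_fun do rewrite subrr; exact: is_Oh0.
Qed.

Lemma approx_cst q (k : R) : fapprox q (fun=> k) (fun=> k).
Proof. by apply: approx_refl; exact: is_Oh_cst. Qed.

Lemma approxD q a b x y : fapprox q a x -> fapprox q b y ->
  fapprox q (fun h => a h + b h) (fun h => x h + y h).
Proof.
move=> [ax x0] [bY y0]; split; last exact: is_OhD.
by under eq_fun do rewrite opprD addrACA; exact: is_OhD.
Qed.

(** The error is a b - x y = (a - x) b + x (b - y), where b is bounded because it is close to the
    bounded y. *)
Lemma approxM q a b x y : fapprox q a x -> fapprox q b y ->
  fapprox q (fun h => a h * b h) (fun h => x h * y h).
Proof.
move=> [ax x0] [bY y0]; split; last exact: (is_OhM 0 0).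
have b0 : is_Oh 0 b by apply: approx_bounded; split; [exact: bY|].
rewrite (_ : (fun h => _) =
    (fun h => (a h - x h) * b h + x h * (b h - y h))); last first.
  by apply/funext => h; ring.
by apply: is_OhD; [rewrite -[q]addn0|rewrite -[q]add0n]; exact: is_OhM.
Qed.

Lemma approxN q a x : fapprox q a x ->
  fapprox q (fun h => - a h) (fun h => - x h).
Proof.
move=> [ax x0]; split; last exact: is_OhN.
by under eq_fun do rewrite -opprD; exact: is_OhN.
Qed.

Lemma approxX q n a x : fapprox q a x ->
  fapprox q (fun h => a h ^+ n) (fun h => x h ^+ n).
Proof.
move=> ax; elim: n => [|n IHn]; first exact: approx_cst.
under eq_fun do rewrite exprS.
under [X in fapprox _ _ X]eq_fun do rewrite exprS.
exact: approxM.
Qed.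

Lemma approx_sum q n (a x : 'I_n -> R -> R) :
  (forall i, fapprox q (a i) (x i)) ->
  fapprox q (fun h => \sum_i a i h) (fun h => \sum_i x i h).
Proof.
elim: n a x => [|n IHn] a x ax.
  under eq_fun do rewrite big_ord0.
  under [X in fapprox _ _ X]eq_fun do rewrite big_ord0.
  exact: approx_cst.
under eq_fun do rewrite big_ord_recl.
under [X in fapprox _ _ X]eq_fun do rewrite big_ord_recl.
by apply: approxD => //; apply: IHn.
Qed.

(** The error is -(a - x) / (a x), and 1 / (a x) is at most 1 / m^2. *)
Lemma approxV q (m : R) a x : 0 < m ->
    (\forall h \near 0^'+, m <= a h) -> (\forall h \near 0^'+, m <= x h) ->
  fapprox q a x -> fapprox q (fun h => (a h)^-1) (fun h => (x h)^-1).
Proof.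
move=> m0 ma mx [ax x0]; split; last first.
  apply: is_Oh_le (is_Oh_cst m^-1); near=> h.
  have mx' : m <= x h by near: h.
  have xh0 : 0 < x h by apply: lt_le_trans mx'.
  by rewrite !ger0_norm ?invr_ge0 ?lef_pV2 ?(ltW m0) ?(ltW xh0).
apply: (@is_Oh_le _ _ (fun h => m^-1 * m^-1 * (a h - x h))); last first.
  by rewrite -[q]add0n; apply: is_OhM => //; exact: is_Oh_cst.
near=> h.
have ma' : m <= a h by near: h.
have mx' : m <= x h by near: h.
have a0 : 0 < a h by apply: lt_le_trans ma'.
have xh0 : 0 < x h by apply: lt_le_trans mx'.
have -> : (a h)^-1 - (x h)^-1 = - ((a h)^-1 * (x h)^-1 * (a h - x h)).
  by field; rewrite (gt_eqF a0) (gt_eqF xh0).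
rewrite normrN !normrM ler_wpM2r// ler_pM// !ger0_norm
  ?invr_ge0 ?(ltW m0) ?(ltW a0) ?(ltW xh0)//.
- by rewrite lef_pV2.
- by rewrite lef_pV2.
Unshelve. all: by end_near. Qed.

(** From a - x = (sqrt a - sqrt x)(sqrt a + sqrt x), where the second factor is at least sqrt m. *)
Lemma approx_sqrt q (m : R) a x : 0 < m ->
    (\forall h \near 0^'+, m <= a h) -> (\forall h \near 0^'+, m <= x h) ->
  fapprox q a x ->
  fapprox q (fun h => Num.sqrt (a h)) (fun h => Num.sqrt (x h)).
Proof.
move=> m0 ma mx [ax x0]; split; last first.
  (* Boundedness of the root follows from t <= 1 + t^2 with t = sqrt x. *)
  apply: (@is_Oh_le _ _ (fun h => 1 + x h)); last first.
    by apply: is_OhD => //; exact: is_Oh_cst.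
  near=> h.
  have mx' : m <= x h by near: h.
  have xh0 : 0 < x h by apply: lt_le_trans mx'.
  rewrite !ger0_norm ?sqrtr_ge0//; last by rewrite addr_ge0 ?ltW.
  have := sqr_sqrtr (ltW xh0); have := sqrtr_ge0 (x h); nra.
apply: (@is_Oh_le _ _ (fun h => (Num.sqrt m)^-1 * (a h - x h))); last first.
  by rewrite -[q]add0n; apply: is_OhM => //; exact: is_Oh_cst.
near=> h.
have ma' : m <= a h by near: h.
have mx' : m <= x h by near: h.
have a0 : 0 < a h by apply: lt_le_trans ma'.
have xh0 : 0 < x h by apply: lt_le_trans mx'.
have sm : 0 < Num.sqrt m by rewrite sqrtr_gt0.
rewrite normrM [X in X * _]ger0_norm ?invr_ge0 ?sqrtr_ge0// mulrC ler_pdivlMr//.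
rewrite -{2}(sqr_sqrtr (ltW a0)) -{2}(sqr_sqrtr (ltW xh0)) subr_sqr normrM.
rewrite ler_wpM2l// ger0_norm ?addr_ge0 ?sqrtr_ge0//.
by rewrite -[Num.sqrt m]addr0 lerD ?sqrtr_ge0 ?ler_wsqrtr.
Unshelve. all: by end_near. Qed.

End BigOh.

(** * Indices, sums and determinants in dimensions 2 and 3 *)

Section SmallMatrices.
Context {R : realType}.

Lemma ord2P (P : 'I_2 -> Prop) : P 0 -> P 1 -> forall i, P i.
Proof.
by move=> P0 P1; case=> [[|[|//]] i2]; [move: P0|move: P1];
  congr P; apply/val_inj.
Qed.

Lemma ord3P (P : 'I_3 -> Prop) : P 0 -> P 1 -> P ord_max -> forall i, P i.
Proof.
by move=> P0 P1 P2; case=> [[|[|[|//]]] i3]; [move: P0|move: P1|move: P2];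
  congr P; apply/val_inj.
Qed.

Lemma sum_ord2 (F : 'I_2 -> R) : \sum_i F i = F 0 + F 1.
Proof.
rewrite big_ord_recl big_ord_recl big_ord0 addr0.
by congr (F _ + F _); apply/val_inj.
Qed.

Lemma sum_ord3 (F : 'I_3 -> R) : \sum_i F i = F 0 + F 1 + F ord_max.
Proof.
rewrite !big_ord_recl big_ord0 addr0 addrA.
by congr (F _ + F _ + F _); apply/val_inj.
Qed.

Lemma det_mx22 (A : 'M[R]_2) : \det A = A 0 0 * A 1 1 - A 0 1 * A 1 0.
Proof.
rewrite (expand_det_row _ 0) sum_ord2 /cofactor !det_mx11 !mxE /=.
rewrite /= !addn0 expr0 expr1 mul1r mulN1r mulrN.
by congr (_ * A _ _ - _ * A _ _); apply/val_inj.
Qed.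

Lemma dotcE n (x y : 'cV[R]_n) : x^T *m y = (dotc x y)%:M.
Proof.
apply/matrixP => i j; rewrite !ord1 !mxE mulr1n.
by apply: eq_bigr => k _; rewrite !mxE.
Qed.

Lemma dotcC n (x y : 'cV[R]_n) : dotc x y = dotc y x.
Proof. by apply: eq_bigr => k _; rewrite mulrC. Qed.

End SmallMatrices.

(** * Exact curvature quantities in terms of the gradient and the Hessian *)

Section PointwiseGeometry.
Context {R : realType}.
Implicit Types (g : 'cV[R]_2) (H : 'M[R]_2) (f : 'cV[R]_2 -> R)
  (p : 'cV[R]_2).

Lemma sqr_ell g : ell g ^+ 2 = 1 + g 0 0 ^+ 2 + g 1 0 ^+ 2.
Proof. by rewrite sqr_sqrtr// -addrA addr_ge0// addr_ge0// sqr_ge0. Qed.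

Lemma ell_ge1 g : 1 <= ell g.
Proof. by rewrite -{1}sqrtr1 ler_wsqrtr// -addrA lerDl addr_ge0// sqr_ge0. Qed.

Lemma ell_gt0 g : 0 < ell g.
Proof. exact: lt_le_trans (ell_ge1 g). Qed.

Lemma ell_neq0 g : ell g != 0.
Proof. by rewrite gt_eqF ?ell_gt0. Qed.

Lemma sqr_enorm g : enorm g ^+ 2 = g 0 0 ^+ 2 + g 1 0 ^+ 2.
Proof.
by rewrite sqr_sqrtr /dotc sum_ord2 -!expr2// addr_ge0// sqr_ge0.
Qed.

Lemma enorm_gt0 g : g != 0 -> 0 < enorm g.
Proof.
move=> g0; rewrite lt0r sqrtr_ge0 andbT; apply: contra_neq g0 => r0.
have := sqr_enorm g; rewrite r0 expr0n /= => /esym/eqP.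
rewrite paddr_eq0 ?sqr_ge0// !sqrf_eq0 => /andP[/eqP g00 /eqP g10].
by apply/matrixP => i j; rewrite (ord1 j) mxE; move: i; apply: ord2P.
Qed.

Lemma enorm0 : enorm (0 : 'cV[R]_2) = 0.
Proof. by apply/eqP; rewrite -sqrf_eq0 sqr_enorm !mxE expr0n addr0. Qed.

(* For [g = 0] any unit vector [(c, s)] qualifies. *)
Definition polar g c s :=
  [/\ g 0 0 = enorm g * c, g 1 0 = enorm g * s & c ^+ 2 + s ^+ 2 = 1].

Lemma dir_unit g : dir_c g ^+ 2 + dir_s g ^+ 2 = 1.
Proof.
rewrite /dir_c /dir_s; case: eqVneq => [_|g0].
  by rewrite expr1n expr0n addr0.
have r0 := enorm_gt0 _ g0.
by rewrite !expr_div_n -mulrDl -sqr_enorm divff// sqrf_eq0 gt_eqF.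
Qed.

Lemma polar_dir g : polar g (dir_c g) (dir_s g).
Proof.
split; last exact: dir_unit.
- rewrite /dir_c; case: eqVneq => [->|g0]; first by rewrite enorm0 mxE mul0r.
  by rewrite mulrC divfK ?gt_eqF ?enorm_gt0.
- rewrite /dir_s; case: eqVneq => [->|g0]; first by rewrite enorm0 mxE mul0r.
  by rewrite mulrC divfK ?gt_eqF ?enorm_gt0.
Qed.

(** The adjugate of J^T J = I + g g^T divided by its determinant [ell g ^+ 2]. *)
Definition inv_first_form g : 'M[R]_2 := (ell g ^+ 2)^-1 *:
  mx_of_rows 2 2 [:: [:: 1 + g 1 0 ^+ 2; - (g 0 0 * g 1 0)];
                     [:: - (g 0 0 * g 1 0); 1 + g 0 0 ^+ 2]].

Lemma inv_first_formP g :
  inv_first_form g *m ((jac g)^T *m jac g) = 1%:M.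
Proof.
have l0 := ell_neq0 g; have l2 := sqr_ell g.
have {l0} : 1 + g 0 0 ^+ 2 + g 1 0 ^+ 2 != 0 by rewrite -l2 expf_neq0.
by move=> d0; apply/matrixP; apply: ord2P; apply: ord2P;
  rewrite !(mxE, sum_ord2, sum_ord3) /= l2; field.
Qed.

Lemma invmx_first_form f p :
  invmx (first_form f p) = inv_first_form (gradient f p).
Proof.
have AG := inv_first_formP (gradient f p).
have [_ Gu] := mulmx1_unit AG.
by rewrite -[RHS](mulmxK Gu) AG mul1mx.
Qed.

Lemma tr_inv_first_form g : (inv_first_form g)^T = inv_first_form g.
Proof.
by apply/matrixP; apply: ord2P; apply: ord2P; rewrite !mxE.
Qed.

Lemma det_inv_first_form g : \det (inv_first_form g) = (ell g ^+ 2)^-1.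
Proof.
have l0 := ell_neq0 g; have l2 := sqr_ell g.
have {l0} d0 : 1 + g 0 0 ^+ 2 + g 1 0 ^+ 2 != 0 by rewrite -l2 expf_neq0.
by rewrite det_mx22 !mxE /= l2; field.
Qed.

Lemma jac_pinvE g : jac_pinv g = inv_first_form g *m (jac g)^T.
Proof.
apply/matrixP; apply: ord2P; apply: ord3P;
  rewrite !(mxE, sum_ord2) /=; ring.
Qed.

Lemma partial_coord (i k : 'I_2) p :
  partial i (fun q : 'cV[R]_2 => q k 0) p = basis_vec i k 0.
Proof.
(* The derivative of the identity map is the direction itself; its component [k] is the claim. *)
have := derive_id p (basis_vec i); rewrite derive_mx//.
by move=> /matrixP/(_ k 0); rewrite mxE.
Qed.

Lemma partial2_coord (i j k : 'I_2) p :
  partial i (partial j (fun q : 'cV[R]_2 => q k 0)) p = 0.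
Proof.
rewrite (_ : partial j _ = cst (basis_vec j k 0)) ?[LHS]derive_cst//.
by apply/funext => q; rewrite partial_coord.
Qed.

(** The first two coordinates of the surface are linear, so only the third has second derivatives,
    and the third component of the normal is 1 / ell. *)
Lemma second_formE f p :
  second_form f p = (ell (gradient f p))^-1 *: hessian f p.
Proof.
apply/matrixP => i j; rewrite [LHS]mxE /dotc sum_ord3 !mxE /=.
rewrite (_ : (fun q => surface f q 0 0) = (fun q => q 0 0)); last first.
  by apply/funext => q; rewrite mxE.
rewrite (_ : (fun q => surface f q 1 0) = (fun q => q 1 0)); last first.
  by apply/funext => q; rewrite mxE.
rewrite (_ : (fun q => surface f q ord_max 0) = f); last first.
  by apply/funext => q; rewrite mxE.
by rewrite !partial2_coord !mulr0 !add0r mulr1.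
Qed.

Lemma weingartenE f p : let g := gradient f p in
  weingarten f p = inv_first_form g *m ((ell g)^-1 *: hessian f p).
Proof. by rewrite /weingarten invmx_first_form second_formE. Qed.

Lemma gauss_curvatureE f p :
  gauss_curvature f p = gauss_formula (gradient f p) (hessian f p).
Proof.
rewrite /gauss_curvature weingartenE det_mulmx /gauss_formula.
set g := gradient f p.
rewrite det_inv_first_form detZ.
by have l0 := ell_neq0 g; field.
Qed.

Lemma mean_curvatureE f p :
  mean_curvature f p = mean_formula (gradient f p) (hessian f p).
Proof.
rewrite /mean_curvature weingartenE /mean_formula.
move: (gradient f p) (hessian f p) => g H.
rewrite /mxtrace !(mxE, sum_ord2) /=.
have l0 := ell_neq0 g; have l2 := sqr_ell g.
(* The inverse first form thus becomes I - g g^T / ell^2, whose product with H has trace tr H - g^T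
   H g / ell^2. *)
have -> : 1 + g 1 0 ^+ 2 = ell g ^+ 2 - g 0 0 ^+ 2 by rewrite l2; ring.
have -> : 1 + g 0 0 ^+ 2 = ell g ^+ 2 - g 1 0 ^+ 2 by rewrite l2; ring.
by field.
Qed.

(** Let G = J^T J and D = [d1 d2]. Orthonormality of the principal directions reads D^T G D = 1, so
    D D^T = G^-1, and C = J W D D^T J^T = J W G^-1 J^T no longer mentions the chosen directions. *)
Lemma curvature_tensorE f p C : is_curvature_tensor f p C ->
  C = tensor_formula (gradient f p) (hessian f p).
Proof.
move=> [k1 [k2 [d1 [d2 [Wd1 Wd2 [e11 e22 e12] ->]]]]].
set g := gradient f p in e11 e22 e12 *; set A := inv_first_form g.
have dGd (x y : 'cV[R]_2) : x^T *m ((jac g)^T *m jac g) *m y =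
    (dotc (jac g *m x) (jac g *m y))%:M.
  by rewrite -dotcE trmx_mul !mulmxA.
pose D : 'M[R]_(2, 1 + 1) := row_mx d1 d2.
have DGD : (D^T *m ((jac g)^T *m jac g)) *m D = 1%:M.
  rewrite /D tr_row_mx mul_col_mx mul_col_row !dGd.
  by rewrite e11 e22 e12 dotcC e12 !raddf0 -scalar_mx_block.
(* One-sided inverses of square matrices are two-sided: D (D^T G) = 1 and G A = 1. *)
have DDA : d1 *m d1^T + d2 *m d2^T = A.
  rewrite -mul_row_col -tr_row_mx -/D -[LHS]mulmx1.
  rewrite -(mulmx1C (inv_first_formP g)) -/A mulmxA.
  by rewrite -(mulmxA D) (mulmx1C DGD) mul1mx.
have JA : (jac_pinv g)^T = jac g *m A.
  by rewrite jac_pinvE trmx_mul trmxK tr_inv_first_form.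
have WA : weingarten f p = A *m ((ell g)^-1 *: hessian f p).
  exact: weingartenE.
rewrite /tensor_formula JA jac_pinvE -/A.
clearbody A.
(* The eigenvector equations turn each [k_i d_i] into W d_i. *)
apply: (@eq_trans _ _ (jac g *m (weingarten f p *m A) *m (jac g)^T)).
  rewrite -DDA mulmxDr !mulmxA Wd1 Wd2 mulmxDr mulmxDl !trmx_mul.
  by rewrite -!(scalemxAl, scalemxAr) !mulmxA.
by rewrite WA -!(scalemxAl, scalemxAr) !mulmxA.
Qed.

(** The displayed shape operator formula with the direction left free, so that a zero gradient can
    be paired with any unit vector. *)
Definition shape_formula_in g H (c s : R) : 'M[R]_2 :=
  (ell g)^-1 *: (mx_of_rows 2 2 [:: [:: c / ell g; s / ell g]; [:: - s; c]]
    *m H *m mx_of_rows 2 2 [:: [:: c / ell g; - s]; [:: s / ell g; c]]).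

(** The frame vectors are tangent, so J^+ returns their coordinates in the basis (x_u, x_v); these
    are their first two components, since J starts with the identity. *)
Lemma jac_pinv_frame g c s : polar g c s ->
  jac_pinv g *m tangent_frame g c s =
  mx_of_rows 2 2 [:: [:: c / ell g; - s]; [:: s / ell g; c]].
Proof.
move=> [g0 g1 cs1].
have l0 := ell_neq0 g; have l2 := sqr_ell g.
have r2 : ell g ^+ 2 = 1 + enorm g ^+ 2 by rewrite l2 sqr_enorm addrA.
have d0 : 1 + enorm g ^+ 2 != 0 by rewrite -r2 expf_neq0.
have s2 : s ^+ 2 = 1 - c ^+ 2 by rewrite -cs1; ring.
apply/matrixP; apply: ord2P; apply: ord2P;
  rewrite !(mxE, sum_ord3) /= r2 g0 g1 ?mulr0 ?addr0 exprMn ?s2.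
all: field: s2; by rewrite ?l0 ?d0.
Qed.

(** With Q = J^+ u, symmetry of G^-1 gives u^T J G^-1 = Q^T, so the operator is Q^T (H / ell) Q. *)
Lemma shape_operator_inE f p c s : polar (gradient f p) c s ->
  shape_operator_in f p c s =
  shape_formula_in (gradient f p) (hessian f p) c s.
Proof.
move=> gcs; rewrite /shape_operator_in; set g := gradient f p.
set u := tangent_frame g c s; set Q := jac_pinv g *m u.
have uJA : u^T *m jac g *m inv_first_form g = Q^T.
  by rewrite /Q jac_pinvE !trmx_mul trmxK tr_inv_first_form mulmxA.
have WA : weingarten f p = inv_first_form g *m ((ell g)^-1 *: hessian f p).
  exact: weingartenE.
have QE := jac_pinv_frame _ _ _ gcs; rewrite -/g -/u -/Q in QE.
rewrite WA; move: (inv_first_form g) uJA => A uJA; clearbody Q.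
rewrite -scalemxAr -scalemxAr -scalemxAl -scalemxAr !mulmxA uJA QE.
congr (_ *: (_ *m _ *m _)).
by apply/matrixP; apply: ord2P; apply: ord2P; rewrite !mxE.
Qed.

Lemma dotc_normal g g' : dotc (unit_normal g) (unit_normal g') =
  (1 + g 0 0 * g' 0 0 + g 1 0 * g' 1 0) / (ell g * ell g').
Proof.
rewrite /dotc sum_ord3 !mxE /=.
by have l0 := ell_neq0 g; have l0' := ell_neq0 g'; field; rewrite l0 l0'.
Qed.

Lemma dotc_normal1 g : dotc (unit_normal g) (unit_normal g) = 1.
Proof.
by rewrite dotc_normal -!expr2 -sqr_ell divff// expf_neq0// ell_neq0.
Qed.

End PointwiseGeometry.

(** * Small angles bounded through their cosine *)

Section Angles.
Context {R : realType}.

(** For t = [acos x], the mean value theorem gives sin t = t cos y with y in [0, t], where cos y >=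
    x >= 1/2. Hence t^2 / 4 <= sin^2 t = (1 - x)(1 + x) <= 2 (1 - x). *)
Lemma acos_sqr_le (x : R) : 2^-1 <= x <= 1 -> acos x ^+ 2 <= 8 * (1 - x).
Proof.
move=> /andP[x2 x1].
have xN1 : -1 <= x <= 1 by apply/andP; split=> //; lra.
have t0 := acos_ge0 xN1; have tpi := acos_lepi xN1.
have cosx : cos (acos x) = x by apply: acosK; rewrite in_itv.
have [y] : exists2 y, y \in `[0, acos x] &
    sin (acos x) - sin 0 = cos y * (acos x - 0).
  apply: MVT_segment => // y; apply: continuous_in_subspaceT => z _.
  exact: continuous_sin.
rewrite in_itv /= => /andP[y0 yx]; rewrite sin0 !subr0 => sinx.
have cosy : 2^-1 <= cos y.
  rewrite (le_trans x2)// -cosx.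
  move: yx; rewrite le_eqVlt => /predU1P[->//|yx]; apply: ltW.
  by rewrite ltr_cos ?in_itv/= ?t0 ?y0 ?(le_trans (ltW yx)).
have := cos2Dsin2 (acos x); rewrite cosx sinx => eq1.
have : 2^-1 * acos x <= cos y * acos x by rewrite ler_wpM2r.
by nra.
Qed.

End Angles.

(** * Stability of the formulas under perturbed data *)

Section Stability.
Context {R : realType}.
Implicit Types (q : nat).

Lemma approx_near_eq q (a b x y : R -> R) :
    (\forall h \near 0^'+, a h = b h) -> (\forall h \near 0^'+, x h = y h) ->
  fapprox q a x -> fapprox q b y.
Proof.
move=> ab xy [ax x0]; split.
  apply: is_Oh_le ax; near=> h.
  by rewrite (_ : a h = b h) 1?(_ : x h = y h)//; near: h.
by apply: is_Oh_le x0; near=> h; rewrite (_ : x h = y h)//; near: h.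
Unshelve. all: by end_near. Qed.

(** A positive order forces convergence to [k]. This supplies the lower bounds required for inverses
    and square roots. *)
Lemma approx_near_ge q (a : R -> R) (k m : R) : (0 < q)%N -> m < k ->
  fapprox q a (fun=> k) -> \forall h \near 0^'+, m <= a h.
Proof.
move=> q0 mk [/(is_OhW 1 q _ q0)/is_OhP[l al] _].
(* Adding 1 keeps the divisor in the threshold for [h] positive. *)
have l0 : 0 < `|l| + 1 by rewrite ltr_wpDl.
have km0 : 0 < k - m by rewrite subr_gt0.
near=> h.
have h0 : 0 < h by near: h; exact: nbhs_right_gt.
have hl : h <= (k - m) / (`|l| + 1).
  by near: h; apply: nbhs_right_le; rewrite divr_gt0.
have alh : `|a h - k| <= l * h ^+ 1 by near: h.
have : `|a h - k| <= k - m.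
  apply: le_trans alh _; rewrite ler_pdivlMr// in hl; apply: le_trans hl.
  rewrite expr1 mulrC ler_wpM2l ?(ltW h0)//.
  by rewrite (le_trans (ler_norm l))// lerDl.
by rewrite ler_norml => /andP[]; lra.
Unshelve. all: by end_near. Qed.

Lemma is_Oh_sqrt q (a : R -> R) :
  is_Oh (q + q) (fun h => a h ^+ 2) -> is_Oh q a.
Proof.
move=> /is_OhP[k ak]; apply/is_OhP; exists (Num.sqrt k); near=> h.
have h0 : 0 < h by near: h; exact: nbhs_right_gt.
have akh : `|a h ^+ 2| <= k * h ^+ (q + q) by near: h.
rewrite -(sqrtr_sqr (a h)) -(ger0_norm (exprn_ge0 q (ltW h0))).
(* Merging the roots requires [0 <= k], which holds because k h^(2q) bounds an absolute value and h
   > 0. *)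
rewrite -sqrtr_sqr -[leRHS]sqrtrM; last first.
  have := le_trans (normr_ge0 _) akh.
  by rewrite pmulr_lge0// exprn_gt0.
by rewrite ler_wsqrtr// -[h ^+ q ^+ 2]exprM muln2 -addnn
  (le_trans (ler_norm _)).
Unshelve. all: by end_near. Qed.

Definition mapprox q {m n} (A B : R -> 'M[R]_(m, n)) :=
  forall i j, fapprox q (fun h => A h i j) (fun h => B h i j).

Lemma approx_mx_cst q m n (A : R -> 'M[R]_(m, n)) (M : 'M[R]_(m, n)) :
  approx_mx q A (fun=> M) -> mapprox q A (fun=> M).
Proof. by move=> AM i j; split; [exact: AM|exact: is_Oh_cst]. Qed.

Lemma mapproxM q m n r (A A' : R -> 'M[R]_(m, n)) (B B' : R -> 'M[R]_(n, r)) :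
  mapprox q A A' -> mapprox q B B' ->
  mapprox q (fun h => A h *m B h) (fun h => A' h *m B' h).
Proof.
move=> AA' BB' i j.
under eq_fun do rewrite mxE; under [X in fapprox _ _ X]eq_fun do rewrite mxE.
by apply: approx_sum => k; exact: approxM.
Qed.

Lemma mapproxZ q m n (a a' : R -> R) (A A' : R -> 'M[R]_(m, n)) :
  fapprox q a a' -> mapprox q A A' ->
  mapprox q (fun h => a h *: A h) (fun h => a' h *: A' h).
Proof.
move=> aa' AA' i j.
under eq_fun do rewrite mxE; under [X in fapprox _ _ X]eq_fun do rewrite mxE.
exact: approxM.
Qed.

Lemma mapprox_tr q m n (A A' : R -> 'M[R]_(m, n)) :
  mapprox q A A' -> mapprox q (fun h => (A h)^T) (fun h => (A' h)^T).
Proof.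
move=> AA' i j.
by under eq_fun do rewrite mxE; under [X in fapprox _ _ X]eq_fun do rewrite mxE.
Qed.

(** * Quantities depending on the gradient alone *)

Section Gradient.
Variables (q : nat) (g : R -> 'cV[R]_2) (g0 : 'cV[R]_2).
Hypothesis gg0 : mapprox q g (fun=> g0).

Lemma approx_ell : fapprox q (fun h => ell (g h)) (fun=> ell g0).
Proof.
apply: (approx_sqrt q 1 _ _ ltr01).
- by near=> h; rewrite -addrA lerDl addr_ge0// sqr_ge0.
- by near=> h; rewrite -addrA lerDl addr_ge0// sqr_ge0.
- by do 2?apply: approxD; [exact: approx_cst|exact: approxX..].
Unshelve. all: by end_near. Qed.

Lemma approx_ellV : fapprox q (fun h => (ell (g h))^-1) (fun=> (ell g0)^-1).
Proof.
apply: (approxV q 1 _ _ ltr01); last exact: approx_ell.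
- by near=> h; exact: ell_ge1.
- by near=> h; exact: ell_ge1.
Unshelve. all: by end_near. Qed.

Lemma approx_normal :
  mapprox q (fun h => unit_normal (g h)) (fun=> unit_normal g0).
Proof.
apply: mapproxZ approx_ellV _ => i j; rewrite (ord1 j).
under eq_fun do rewrite mxE; under [X in fapprox _ _ X]eq_fun do rewrite mxE.
by move: i; apply: ord3P => /=; [exact: approxN..|exact: approx_cst].
Qed.

Lemma approx_jac_pinv :
  mapprox q (fun h => jac_pinv (g h)) (fun=> jac_pinv g0).
Proof.
apply: mapproxZ.
  under eq_fun do rewrite -exprVn.
  under [X in fapprox _ _ X]eq_fun do rewrite -exprVn.
  exact/approxX/approx_ellV.
move=> i j.
under eq_fun do rewrite mxE; under [X in fapprox _ _ X]eq_fun do rewrite mxE.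
have diag (k : 'I_2) :
    fapprox q (fun h => 1 + g h k 0 ^+ 2) (fun=> 1 + g0 k 0 ^+ 2).
  by apply: approxD; [exact: approx_cst|exact: approxX].
have off :
    fapprox q (fun h => - (g h 0 0 * g h 1 0)) (fun=> - (g0 0 0 * g0 1 0)).
  by apply: approxN; exact: approxM.
by move: i j; apply: ord2P; apply: ord3P => /=;
  first [exact: diag|exact: off|exact: gg0].
Qed.

(** Near a nonzero gradient the squared norm of [g h] eventually exceeds half its limit, so the norm
    can be inverted and the default value of (c, s) is never taken. *)
Lemma approx_dir : (0 < q)%N -> g0 != 0 ->
  fapprox q (fun h => dir_c (g h)) (fun=> dir_c g0) /\
  fapprox q (fun h => dir_s (g h)) (fun=> dir_s g0).
Proof.
move=> q0 g0N0.
have sqE (x : 'cV[R]_2) : dotc x x = enorm x ^+ 2.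
  by rewrite sqr_enorm /dotc sum_ord2 -!expr2.
have dgg0 : fapprox q (fun h => dotc (g h) (g h)) (fun=> dotc g0 g0).
  by apply: approx_sum => k; exact: approxM.
have r0 : 0 < dotc g0 g0 by rewrite sqE exprn_gt0// enorm_gt0.
set m := dotc g0 g0 / 2.
have m0 : 0 < m by rewrite divr_gt0.
have mr0 : m < dotc g0 g0 by rewrite /m; lra.
have mg := approx_near_ge q _ _ _ q0 mr0 dgg0.
have en : fapprox q (fun h => enorm (g h)) (fun=> enorm g0).
  by apply: (approx_sqrt q m) => //; near=> h; exact: ltW.
have enV : fapprox q (fun h => (enorm (g h))^-1) (fun=> (enorm g0)^-1).
  apply: (approxV q (Num.sqrt m)) => //.
  - by rewrite sqrtr_gt0.
  - by near=> h; rewrite ler_wsqrtr//; near: h.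
  - by near=> h; rewrite ler_wsqrtr// ltW.
have gN0 : \forall h \near 0^'+, g h != 0.
  near=> h; apply: contraTneq m0 => gh0; rewrite -leNgt.
  suff -> : 0 = dotc (g h) (g h) by near: h.
  by rewrite gh0 sqE enorm0 expr0n.
by split; (apply: approx_near_eq (approxM _ _ _ _ _ (gg0 _ 0) enV);
  [near=> h; rewrite /dir_c /dir_s ifN//; near: h
  |near=> h; rewrite /dir_c /dir_s ifN]).
Unshelve. all: by end_near. Qed.

Lemma is_Oh_angle_normal : (0 < q)%N ->
  is_Oh q (fun h => angle (unit_normal (g h)) (unit_normal g0)).
Proof.
move=> q0; pose x h := dotc (unit_normal (g h)) (unit_normal g0).
(* Expansion of the squared distance of two unit vectors. *)
have x1 h : 1 - x h =
    2^-1 * \sum_i (unit_normal (g h) i 0 - unit_normal g0 i 0) ^+ 2.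
  rewrite [X in X - _](_ : 1 = 2^-1 *
      (dotc (unit_normal (g h)) (unit_normal (g h)) +
       dotc (unit_normal g0) (unit_normal g0))); last first.
    by rewrite !dotc_normal1; field.
  by rewrite /x /dotc !sum_ord3; field.
have xle1 h : x h <= 1.
  by rewrite -subr_ge0 x1 mulr_ge0// sumr_ge0// => i _; exact: sqr_ge0.
have O1x : is_Oh (q + q) (fun h => 1 - x h).
  under eq_fun do rewrite x1 sum_ord3 !expr2.
  rewrite -[(q + q)%N]add0n; apply: is_OhM; first exact: is_Oh_cst.
  by do 2?apply: is_OhD; apply: is_OhM; exact: (approx_normal _ _).1.
(* The bound on [acos] is available only once the cosine is at least 1/2. *)
have xge : \forall h \near 0^'+, 2^-1 <= x h.
  apply: (approx_near_ge q _ 1) => //; first lra.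
  split; last exact: is_Oh_cst.
  under eq_fun do rewrite -opprB.
  by apply: is_OhN; apply: is_OhW O1x; rewrite leq_addr.
apply: is_Oh_sqrt; apply: (@is_Oh_le _ _ _ (fun h => 8 * (1 - x h))).
  near=> h; rewrite /angle /enorm !dotc_normal1 sqrtr1 mulr1 divr1 -/(x h).
  have xh : 2^-1 <= x h by near: h.
  rewrite !ger0_norm ?sqr_ge0 ?mulr_ge0 ?subr_ge0//.
  by apply: acos_sqr_le; rewrite xh xle1.
by rewrite -[(q + q)%N]add0n; apply: is_OhM => //; exact: is_Oh_cst.
Unshelve. all: by end_near. Qed.

(** * Formulas that also involve the Hessian *)

Section Hessian.
Variables (H : R -> 'M[R]_2) (H0 : 'M[R]_2).
Hypothesis HH0 : mapprox q H (fun=> H0).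

(** The reference direction may vary with h: this covers both the exact direction and the computed
    one used on both sides. *)
Lemma approx_shape_formula_in (c s c0 s0 : R -> R) :
  fapprox q c c0 -> fapprox q s s0 ->
  mapprox q (fun h => shape_formula_in (g h) (H h) (c h) (s h))
            (fun h => shape_formula_in g0 H0 (c0 h) (s0 h)).
Proof.
move=> cc0 ss0; apply: mapproxZ approx_ellV _.
have cl := approxM _ _ _ _ _ cc0 approx_ellV.
have sl := approxM _ _ _ _ _ ss0 approx_ellV.
have Ns := approxN _ _ _ ss0.
by apply: mapproxM => [|i j]; first (apply: mapproxM => // i j);
  under eq_fun do rewrite mxE; under [X in fapprox _ _ X]eq_fun do rewrite mxE;
  move: i j; apply: ord2P; apply: ord2P.
Qed.

Lemma approx_tensor_formula :
  mapprox q (fun h => tensor_formula (g h) (H h)) (fun=> tensor_formula g0 H0).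
Proof.
apply: mapproxZ approx_ellV _; apply: mapproxM approx_jac_pinv.
by apply: mapproxM => //; exact/mapprox_tr/approx_jac_pinv.
Qed.

Lemma approx_gauss_formula :
  fapprox q (fun h => gauss_formula (g h) (H h)) (fun=> gauss_formula g0 H0).
Proof.
rewrite /gauss_formula; apply: approxM; last first.
  under eq_fun do rewrite -exprVn.
  under [X in fapprox _ _ X]eq_fun do rewrite -exprVn.
  exact/approxX/approx_ellV.
under eq_fun do rewrite det_mx22.
under [X in fapprox _ _ X]eq_fun do rewrite det_mx22.
by apply: approxD; [|apply: approxN]; exact: approxM.
Qed.

Lemma approx_mean_formula :
  fapprox q (fun h => mean_formula (g h) (H h)) (fun=> mean_formula g0 H0).
Proof.
rewrite /mean_formula; apply: approxD; [|apply: approxN]; apply: approxM.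
- by apply: approx_sum => i.
- under eq_fun do rewrite invfM.
  under [X in fapprox _ _ X]eq_fun do rewrite invfM.
  by apply: approxM approx_ellV; exact: approx_cst.
- by apply: mapproxM => //; apply: mapproxM => //; exact: mapprox_tr.
- under eq_fun do rewrite invfM -exprVn.
  under [X in fapprox _ _ X]eq_fun do rewrite invfM -exprVn.
  by apply: approxM; [exact: approx_cst|exact/approxX/approx_ellV].
Qed.

End Hessian.
End Gradient.

(** Entries of a unit vector lie in [-1, 1], whether or not the direction converges. *)
Lemma is_Oh_dir (g : R -> 'cV[R]_2) :
  is_Oh 0 (fun h => dir_c (g h)) /\ is_Oh 0 (fun h => dir_s (g h)).
Proof.
by split; (apply: is_Oh_le (is_Oh_cst 1); near=> h;
  have := dir_unit (g h); rewrite normr1 ler_norml => eq1;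
  apply/andP; split; nra).
Unshelve. all: by end_near. Qed.

End Stability.

(** * Accuracy of the normal, the shape operator and the curvatures *)

Theorem theorem5 (R : realType) (d : nat) (U : set 'cV[R]_2)
    (f : 'cV[R]_2 -> R) (p : 'cV[R]_2)
    (xh : R -> 'cV[R]_3) (gh : R -> 'cV[R]_2) (Hh : R -> 'M[R]_2)
    (d_gt0 : (0 < d)%N) (Uopen : open U) (Up : U p) (f_smooth : smooth_on U f)
    (Hh_sym : \forall h \near 0^'+, (Hh h)^T = Hh h)
    (x_approx : approx_mx d.+1 xh (fun=> surface f p))
    (g_approx : approx_mx d gh (fun=> gradient f p))
    (H_approx : approx_mx d.-1 Hh (fun=> hessian f p)) :
  [/\ is_Oh d (fun h => angle (unit_normal (gh h)) (unit_normal (gradient f p))),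
      [/\ (gradient f p != 0 \/ d = 1%N ->
             approx_mx d.-1 (fun h => shape_formula (gh h) (Hh h))
                            (fun=> shape_operator f p)),
          (gradient f p = 0 ->
             approx_mx d.-1 (fun h => shape_formula (gh h) (Hh h))
               (fun h => shape_operator_in f p (dir_c (gh h)) (dir_s (gh h)))) &
          (forall C : 'M[R]_3, is_curvature_tensor f p C ->
             approx_mx d.-1 (fun h => tensor_formula (gh h) (Hh h)) (fun=> C))],
      is_Oh d.-1 (fun h => gauss_formula (gh h) (Hh h) - gauss_curvature f p) &
      is_Oh d.-1 (fun h => mean_formula (gh h) (Hh h) - mean_curvature f p)].
Proof.
have gd := approx_mx_cst _ _ _ _ _ g_approx.
have Hd := approx_mx_cst _ _ _ _ _ H_approx.
(* The Hessian limits every formula containing it to order [d.-1]; the normal keeps the full order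
   [d]. *)
have gd1 : mapprox d.-1 gh (fun=> gradient f p).
  by move=> i j; apply: approxW (gd i j); exact: leq_pred.
have [bc bs] := is_Oh_dir gh.
split; first exact: is_Oh_angle_normal.
- split.
  + move=> g0d.
    have [cd sd] :
        fapprox d.-1 (fun h => dir_c (gh h)) (fun=> dir_c (gradient f p)) /\
        fapprox d.-1 (fun h => dir_s (gh h)) (fun=> dir_s (gradient f p)).
      case: g0d => [g0|d1].
        (* Applied at order [d], which is positive, and weakened only afterwards, as [d.-1] may be
           0. *)
        have [cd sd] := approx_dir _ _ _ gd d_gt0 g0.
        by split; [apply: approxW cd|apply: approxW sd]; exact: leq_pred.
      (* For [d = 1] the claim has order 0, and the difference of two bounded directions is
         bounded. *)
      by rewrite d1; split; (split; last exact: is_Oh_cst);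
        apply: is_OhB => //; exact: is_Oh_cst.
    move=> i j; rewrite /shape_operator shape_operator_inE;
      last exact: polar_dir.
    exact: (approx_shape_formula_in _ _ _ gd1 _ _ Hd _ _ _ _ cd sd i j).1.
  + move=> g0 i j.
    (* At a zero gradient the computed direction is an admissible frame for the exact operator, so
       no convergence of (c, s) is required. *)
    have polar0 h : polar (gradient f p) (dir_c (gh h)) (dir_s (gh h)).
      by split; [rewrite g0 enorm0 mxE mul0r..|exact: dir_unit].
    under eq_fun do rewrite shape_operator_inE//.
    exact: (approx_shape_formula_in _ _ _ gd1 _ _ Hd _ _ _ _
      (approx_refl _ _ bc) (approx_refl _ _ bs) i j).1.
  + move=> C /curvature_tensorE -> i j.
    exact: (approx_tensor_formula _ _ _ gd1 _ _ Hd i j).1.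
- by rewrite gauss_curvatureE; exact: (approx_gauss_formula _ _ _ gd1 _ _ Hd).1.
- by rewrite mean_curvatureE; exact: (approx_mean_formula _ _ _ gd1 _ _ Hd).1.
Qed.
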